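(* Suppose that $\Xi=\mathbb{R}^{m_1}\times\{\xi_T\}$ for a fixed $\xi_T\in\mathbb{R}^{m_2}$. Then for any $p\in[1,\infty]$ and every $x\in\mathcal X$, $$\mathcal Z(x)=\frac1N\sum_{j\in[N]}\min_{y\in\mathbb{R}^{n_2}}\left\{(Q\zeta_q^j+q)^\top y+\theta\|Q^\top y\|_{p*}:\ T(x)\xi_T+Wy\ge h(x)\right\},$$ where $\|\cdot\|_{p*}$ is the dual norm of $\|\cdot\|_p$, $p*=\frac{p}{p-1}$ (with $p*=\infty$ for $p=1$ and $p*=1$ for $p=\infty$).
   Context: Setting. $[k]=\{1,\dots,k\}$. Let $n_1,n_2,m_1,m_2,\ell,N$ be positive integers, $\mathcal X\subseteq\mathbb{R}^{n_1}$, $c\in\mathbb{R}^{n_1}$, $W\in\mathbb{R}^{\ell\times n_2}$, $Q\in\mathbb{R}^{n_2\times m_1}$, $q\in\mathbb{R}^{n_2}$ fixed, and let $h:\mathbb{R}^{n_1}\to\mathbb{R}^{\ell}$ and $T:\mathbb{R}^{n_1}\to\mathbb{R}^{\ell\times m_2}$ be affine. The support is $\Xi=\Xi_q\times\Xi_T$ with $\Xi_q\subseteq\mathbb{R}^{m_1}$, $\Xi_T\subseteq\mathbb{R}^{m_2}$. For $\xi=(\xi_q,\xi_T)\in\Xi$ the recourse function is $$Z(x,\xi)=\min_{y\in\mathbb{R}^{n_2}}\{(Q\xi_q+q)^\top y:\ T(x)\xi_T+Wy\ge h(x)\}.$$ Minima are read as infima, equal to $+\infty$ if infeasible. Ambiguity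 set. Given $p\in[1,\infty]$, $\theta\ge0$ and points $\zeta^j=(\zeta_q^j,\zeta_T^j)\in\Xi$, $j\in[N]$, let $\mathbb{P}_{\tilde\zeta}$ be the empirical distribution putting mass $1/N$ on each $\zeta^j$. Let $W^\infty(\mathbb{P}_1,\mathbb{P}_2)$ be the infimum, over all joint distributions $\mathbb{Q}$ of $(\tilde\xi_1,\tilde\xi_2)$ with marginals $\mathbb{P}_1,\mathbb{P}_2$, of the $\mathbb{Q}$-essential supremum of $\|\tilde\xi_1-\tilde\xi_2\|_p$, where $\|\cdot\|_p$ is the $\ell_p$ norm on $\mathbb{R}^{m_1+m_2}$. Let $\mathcal P=\{\mathbb{P}:\mathbb{P}(\tilde\xi\in\Xi)=1,\ W^\infty(\mathbb{P},\mathbb{P}_{\tilde\zeta})\le\theta\}$ and $\mathcal Z(x)=\sup_{\mathbb{P}\in\mathcal P}\mathbb{E}_{\mathbb{P}}[Z(x,\tilde\xi)]$. Standing assumption (sufficiently expensive recourse). For all $x\in\mathcal X$ and $\xi\in\Xi$ the dual of the recourse problem is feasible, i.e. there is $\pi\in\mathbb{R}_+^\ell$ with $W^\top\pi=Q\xi_q+q$. *)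

(* Defs.v *)
From HB Require Import structures.
From mathcomp Require Import all_boot all_order all_algebra.
From mathcomp Require Import all_classical all_reals all_analysis.
From mathcomp Require Import ess_sup_inf hoelder.

Set Implicit Arguments.
Unset Strict Implicit.
Unset Printing Implicit Defensive.

Import Order.TTheory GRing.Theory Num.Theory.
Import numFieldNormedType.Exports.

Local Open Scope classical_set_scope.
Local Open Scope ring_scope.

Definition affine_map (R : realType) (U V : lmodType R) (f : U -> V) : Prop :=
  exists (L : {linear U -> V}) (b : V), forall x, f x = L x + b.

Definition dotv (R : realType) (n : nat) (u v : 'cV[R]_n) : R :=
  (u^T *m v) ord0 ord0.

(* Meaningful for 1 <= p only; the value at -oo is junk. *)
Definition lpnorm (R : realType) (p : \bar R) (n : nat) (u : 'cV[R]_n) : R :=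
  match p with
  | r%:E => (\sum_(i < n) `|u i ord0| `^ r) `^ r^-1
  | +oo%E => \big[Num.max/0]_(i < n) `|u i ord0|
  | -oo%E => 0
  end.

(* R^m with its Borel sigma-algebra. *)
Notation borel_cV R m := (g_sigma_algebraType (@open 'cV[R]_m)).

(* A vector xi of R^(m1 + m2) is the pair (xi_q, xi_T) of its upper and lower
   blocks, xi_q = usubmx xi and xi_T = dsubmx xi. *)
Definition support_prod (R : realType) (m1 m2 : nat)
    (Xi_q : set 'cV[R]_m1) (Xi_T : set 'cV[R]_m2) : set 'cV[R]_(m1 + m2) :=
  [set xi | Xi_q (usubmx xi) /\ Xi_T (dsubmx xi)].

Definition recourse_feasible (R : realType) (n1 n2 m2 l : nat)
    (W : 'M[R]_(l, n2)) (h : 'cV[R]_n1 -> 'cV[R]_l)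
    (T : 'cV[R]_n1 -> 'M[R]_(l, m2)) (x : 'cV[R]_n1) (xiT : 'cV[R]_m2) :
    set 'cV[R]_n2 :=
  [set y | forall i : 'I_l,
     h x i ord0 <= (T x *m xiT + W *m y) i ord0].

(* The infimum of the empty set is +oo. *)
Definition recourse (R : realType) (n1 n2 m1 m2 l : nat)
    (W : 'M[R]_(l, n2)) (Q : 'M[R]_(n2, m1)) (q : 'cV[R]_n2)
    (h : 'cV[R]_n1 -> 'cV[R]_l) (T : 'cV[R]_n1 -> 'M[R]_(l, m2))
    (x : 'cV[R]_n1) (xi : 'cV[R]_(m1 + m2)) : \bar R :=
  ereal_inf [set (dotv (Q *m usubmx xi + q) y)%:E
            | y in recourse_feasible W h T x (dsubmx xi)].

Definition expensive_recourse (R : realType) (n1 n2 m1 m2 l : nat)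
    (X : set 'cV[R]_n1) (Xi : set 'cV[R]_(m1 + m2))
    (W : 'M[R]_(l, n2)) (Q : 'M[R]_(n2, m1)) (q : 'cV[R]_n2) : Prop :=
  forall x xi, X x -> Xi xi ->
    exists pi : 'cV[R]_l,
      (forall i, 0 <= pi i ord0) /\ W^T *m pi = Q *m usubmx xi + q.

Section empirical.
Context d (T : measurableType d) (R : realType) (N : nat) (zeta : 'I_N -> T).

Definition empirical (A : set T) : \bar R :=
  ((N%:R^-1)%:E * \sum_(j < N) \d_(zeta j) A)%E.

Let empirical0 : empirical set0 = 0%E.
Proof.
by rewrite /empirical big1 ?mule0// => j _; rewrite measure0.
Qed.

Let empirical_ge0 A : (0 <= empirical A)%E.
Proof.
by rewrite /empirical mule_ge0 ?lee_fin ?invr_ge0// sume_ge0.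
Qed.

Let empirical_sigma_additive : semi_sigma_additive empirical.
Proof.
move=> F mF tF mUF; rewrite /empirical.
rewrite (_ : (fun n => _) = (fun n => (N%:R^-1)%:E *
    \sum_(j < N) \sum_(0 <= i < n) \d_(zeta j) (F i))%E); last first.
  apply/funext => n; rewrite exchange_big/= ge0_sume_distrr// => i _.
  by rewrite sume_ge0.
apply: cvgeZl => //; apply: cvg_nnesum.
- by move=> j _; apply: nearW => n; rewrite sume_ge0.
- by move=> j _; exact: measure_semi_sigma_additive.
Qed.

HB.instance Definition _ := isMeasure.Build d T R empirical
  empirical0 empirical_ge0 empirical_sigma_additive.

Lemma empirical_setT : (0 < N)%N -> empirical [set: T] = 1%E.
Proof.
move=> N0; rewrite /empirical.
under eq_bigr do rewrite diracT.
by rewrite sumEFin sumr_const card_ord -EFinM mulVf// pnatr_eq0 -lt0n.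
Qed.

End empirical.

Definition coupling d (T : measurableType d) (R : realType)
    (P1 P2 : {measure set T -> \bar R}) : set (probability (T * T)%type R) :=
  [set Q | forall A, measurable A ->
     Q (fst @^-1` A) = P1 A /\ Q (snd @^-1` A) = P2 A].

Definition wasserstein_infty (R : realType) (p : \bar R) (m : nat)
    (P1 P2 : {measure set (borel_cV R m) -> \bar R}) : \bar R :=
  ereal_inf [set ess_sup Q
      (fun z => (lpnorm p ((z.1 : 'cV[R]_m) - (z.2 : 'cV[R]_m)))%:E)
    | Q in coupling P1 P2].

Definition ambiguity_set (R : realType) (p : \bar R) (m N : nat) (theta : R)
    (Xi : set 'cV[R]_m) (zeta : 'I_N -> borel_cV R m) :
    set (probability (borel_cV R m) R) :=
  [set P : probability (borel_cV R m) R | P Xi = 1%E /\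
           (wasserstein_infty p P (empirical R zeta) <= theta%:E)%E].

(* Z is only considered on Xi, which carries the full mass of P, hence the
   expectation is the integral over Xi. *)
Definition worst_case (R : realType) (n1 n2 m1 m2 l N : nat)
    (Xi : set 'cV[R]_(m1 + m2))
    (W : 'M[R]_(l, n2)) (Q : 'M[R]_(n2, m1)) (q : 'cV[R]_n2)
    (h : 'cV[R]_n1 -> 'cV[R]_l) (T : 'cV[R]_n1 -> 'M[R]_(l, m2))
    (p : \bar R) (theta : R) (zeta : 'I_N -> 'cV[R]_(m1 + m2))
    (x : 'cV[R]_n1) : \bar R :=
  ereal_sup [set (\int[P]_(xi in Xi) recourse W Q q h T x xi)%E
            | P in ambiguity_set p theta Xi zeta].

(* Main.v *)
Require Import Defs.
From HB Require Import structures.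
From mathcomp Require Import all_boot all_order all_algebra.
From mathcomp Require Import all_classical all_reals all_analysis.
From mathcomp Require Import ess_sup_inf hoelder.
From mathcomp Require Import measurable_realfun ring lra.
Set Implicit Arguments.
Unset Strict Implicit.
Unset Printing Implicit Defensive.
Import Order.TTheory GRing.Theory Num.Theory.
Import numFieldNormedType.Exports.
Local Open Scope classical_set_scope.
Local Open Scope ring_scope.

(** Write [G t zeta] for the infimum over feasible [y] of
    [(Q zeta_q + q)^T y + t ||Q^T y||_{p*}], so that [Z = G 0] on the support.
    Upper bound: by Hoelder, [G 0 xi <= G t zeta] as soon as
    [||xi - zeta||_p <= t]; integrating this along a coupling of cost at most
    [t = theta + d] and letting [d] decrease to [0] (an infimum of affine
    functions of [t] is upper semicontinuous) bounds every expectation, without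
    any need for an optimal coupling.
    Lower bound: by a minimax theorem on the compact ball [||u||_p <= theta], the
    robust value [G theta zeta^j] is attained as [G 0 xi^j] for some [xi^j] at
    distance at most [theta] from [zeta^j], and the empirical distribution of the
    [xi^j] lies in the ambiguity set. *)

(** * Duality of the l_p norms *)

Section lp_duality.
Context {R : realType}.
Implicit Types (p : \bar R) (r s : R).

Lemma dotvE n (u v : 'cV[R]_n) : dotv u v = \sum_i u i ord0 * v i ord0.
Proof. by rewrite /dotv mxE; apply: eq_bigr => i _; rewrite mxE. Qed.

Lemma lpnorm1E n (u : 'cV[R]_n) : lpnorm 1%E u = \sum_i `|u i ord0|.
Proof.
rewrite /lpnorm invr1 powRr1; last by apply: sumr_ge0 => i _; exact: powR_ge0.
by apply: eq_bigr => i _; rewrite powRr1.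
Qed.

Lemma lpnorm_ge0 p n (u : 'cV[R]_n) : 0 <= lpnorm p u.
Proof. by case: p => [r| |]//=; [exact: powR_ge0|exact: bigmax_ge_id]. Qed.

(** The injection places the coordinates of [u] among those of [v], and the remaining ones can only
    increase the norm; this serves to bound the norm of a block. *)
Lemma le_lpnorm_embed p m n (u : 'cV[R]_m) (v : 'cV[R]_n) (f : 'I_m -> 'I_n) :
  (0 < p)%E -> injective f -> (forall i, `|u i ord0| <= `|v (f i) ord0|) ->
  lpnorm p u <= lpnorm p v.
Proof.
move=> p0 finj uv; case: p p0 => [r| |]//=; last first.
  move=> _; apply/bigmax_leP; split=> [|i _]; first exact: bigmax_ge_id.
  by apply: (le_trans (uv i)); exact: le_bigmax.
rewrite lte_fin => r0.
apply: ge0_ler_powR; rewrite ?invr_ge0 ?(ltW r0)// ?nnegrE.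
- by apply: sumr_ge0 => i _; exact: powR_ge0.
- by apply: sumr_ge0 => i _; exact: powR_ge0.
rewrite [leRHS](bigID [in codom f])/= -big_uniq; last exact/injectiveP.
rewrite big_image/= ler_wpDr//; first by apply: sumr_ge0 => i _; exact: powR_ge0.
apply: ler_sum => i _; apply: ge0_ler_powR; rewrite ?(ltW r0)//.
Qed.

Lemma lpnorm_usubmx_le p m n (u : 'cV[R]_(m + n)) : (0 < p)%E ->
  lpnorm p (usubmx u) <= lpnorm p u.
Proof.
move=> p0; apply: (@le_lpnorm_embed _ _ _ _ _ (lshift n)) => //.
  exact: lshift_inj.
by move=> i; rewrite mxE.
Qed.

Lemma lpnorm_col_mx0 p m n (u : 'cV[R]_m) : (0 < p)%E ->
  lpnorm p (col_mx u (0 : 'cV[R]_n)) = lpnorm p u.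
Proof.
case: p => [r| |]//=; rewrite ?lte_fin => r0.
  congr (_ `^ _); rewrite big_split_ord/= [X in _ + X]big1 ?addr0.
    by apply: eq_bigr => i _; rewrite col_mxEu.
  by move=> i _; rewrite col_mxEd mxE normr0 powR0 ?gt_eqF.
apply/eqP; rewrite eq_le; apply/andP; split; apply/bigmax_leP; split.
- exact: bigmax_ge_id.
- move=> i _; case: (split_ordP i) => j ->; rewrite ?col_mxEu ?col_mxEd.
    exact: (le_bigmax _ (fun j => `|u j ord0|)).
  by rewrite mxE normr0; exact: bigmax_ge_id.
- exact: bigmax_ge_id.
- move=> i _; apply: le_trans (le_bigmax _ _ (lshift n i)).
  by rewrite col_mxEu.
Qed.

(** Spelling out the three cases makes the relation symmetric and keeps extended-real arithmetic out
    of the Hoelder arguments; the finite case has the form that Young's inequality expects. *)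
Variant conjugate_exponents : \bar R -> \bar R -> Prop :=
| ConjugateOneInfty : conjugate_exponents 1%E +oo%E
| ConjugateInftyOne : conjugate_exponents +oo%E 1%E
| ConjugateFinite r s of 1 < r & 1 < s & r^-1 + s^-1 = 1 :
    conjugate_exponents r%:E s%:E.

Lemma hoelder_conjugateW p : (1 <= p)%E ->
  conjugate_exponents p (hoelder_conjugate p).
Proof.
case: p => [r| |]//; rewrite ?hoelder_conjugatey; last by constructor.
rewrite lee_fin le_eqVlt => /predU1P[<-|r1].
  by rewrite hoelder_conjugate1; constructor.
have r0 : 0 < r by apply: lt_trans r1.
have -> : hoelder_conjugate r%:E = (r / (r - 1))%:E.
  rewrite /hoelder_conjugate/= eqe gt_eqF//.
  by rewrite -EFinD inver subr_eq0 gt_eqF// -EFinM.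
have r10 : 0 < r - 1 by rewrite subr_gt0.
constructor => //.
  by rewrite ltr_pdivlMr// mul1r ltrBlDr ltrDl.
by rewrite invf_div; field; rewrite gt_eqF.
Qed.

Lemma conjugate_exponentsC p q :
  conjugate_exponents p q -> conjugate_exponents q p.
Proof.
by case=> [||r s r1 s1 rs]; constructor => //; rewrite addrC.
Qed.

Lemma dotv_le_lpnorm1y n (u v : 'cV[R]_n) :
  dotv u v <= lpnorm 1%E u * lpnorm +oo%E v.
Proof.
rewrite dotvE lpnorm1E mulr_suml; apply: ler_sum => i _.
rewrite (le_trans (ler_norm _))// normrM ler_wpM2l//.
exact: (le_bigmax _ (fun j => `|v j ord0|)).
Qed.

Lemma dotvC n (u v : 'cV[R]_n) : dotv u v = dotv v u.
Proof. by rewrite !dotvE; apply: eq_bigr => i _; rewrite mulrC. Qed.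

Lemma powR_sumK n (u : 'cV[R]_n) r : 0 < r ->
  lpnorm r%:E u `^ r = \sum_i `|u i ord0| `^ r.
Proof.
move=> r0; rewrite /= -powRrM mulVf ?gt_eqF// powRr1//.
by apply: sumr_ge0 => i _; exact: powR_ge0.
Qed.

Lemma lpnorm_eq0 n (u : 'cV[R]_n) r : 0 < r -> lpnorm r%:E u = 0 -> u = 0.
Proof.
move=> r0 u0; apply/colP => i; rewrite mxE.
have /eqP := powR_sumK u r0.
rewrite u0 powR0 ?(gt_eqF r0)// eq_sym psumr_eq0; last first.
  by move=> j _; exact: powR_ge0.
by move=> /allP/(_ i (mem_index_enum _))/eqP/powR_eq0_eq0/normr0P/eqP.
Qed.

(** With both norms scaled to one, Young's inequality in each coordinate sums to [r^-1 + s^-1 = 1].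
    Zero norms, which forbid scaling, are treated first. *)
Lemma dotv_le_lpnorm_fin n (u v : 'cV[R]_n) r s : 1 < r -> 1 < s ->
  r^-1 + s^-1 = 1 -> dotv u v <= lpnorm r%:E u * lpnorm s%:E v.
Proof.
move=> r1 s1 rs.
have r0 : 0 < r by apply: lt_trans r1.
have s0 : 0 < s by apply: lt_trans s1.
have [u0|u0] := eqVneq (lpnorm r%:E u) 0.
  rewrite u0 (lpnorm_eq0 r0 u0) mul0r dotvE big1// => i _.
  by rewrite mxE mul0r.
have [v0|v0] := eqVneq (lpnorm s%:E v) 0.
  rewrite v0 (lpnorm_eq0 s0 v0) mulr0 dotvE big1// => i _.
  by rewrite mxE mulr0.
have := powR_sumK u r0; have := powR_sumK v s0.
have : 0 < lpnorm r%:E u by rewrite lt_neqAle eq_sym u0 lpnorm_ge0.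
have : 0 < lpnorm s%:E v by rewrite lt_neqAle eq_sym v0 lpnorm_ge0.
move: (lpnorm s%:E v) (lpnorm r%:E u) => b a b0 a0 hb ha {u0 v0}.
rewrite -[leRHS]mulr1 -ler_pdivrMl ?mulr_gt0// dotvE mulr_sumr.
apply: (@le_trans _ _ (\sum_i ((`|u i ord0| `^ r / a `^ r) / r
                         + (`|v i ord0| `^ s / b `^ s) / s))).
  apply: ler_sum => i _.
  have -> : (a * b)^-1 * (u i ord0 * v i ord0) = (u i ord0 / a) * (v i ord0 / b).
    by rewrite invfM; ring.
  rewrite (le_trans (ler_norm _))// normrM.
  apply: (le_trans (conjugate_powR _ _ r0 s0 rs)) => //.
  rewrite !normrM !powRM// !normfV (gtr0_norm a0) (gtr0_norm b0).
  have pV (c t : R) : 0 < c -> c^-1 `^ t = (c `^ t)^-1.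
    by move=> c0; rewrite -powR_inv1 ?ltW// -powRrM mulN1r powRN.
  by rewrite !pV.
rewrite big_split/= -!mulr_suml -ha -hb !divff ?mul1r ?rs//.
  by rewrite gt_eqF// powR_gt0.
by rewrite gt_eqF// powR_gt0.
Qed.

Lemma dotv_le_lpnorm p q n (u v : 'cV[R]_n) : conjugate_exponents p q ->
  dotv u v <= lpnorm p u * lpnorm q v.
Proof.
case=> [||r s]; first exact: dotv_le_lpnorm1y.
  by rewrite dotvC mulrC; exact: dotv_le_lpnorm1y.
exact: dotv_le_lpnorm_fin.
Qed.

(** The equality case of Hoelder: a signed unit vector at a coordinate of largest modulus when [p]
    is one, the sign vector when [p] is infinite, and normalised signed powers of the entries
    otherwise. *)
Lemma lpnorm_dual_attained p q n (v : 'cV[R]_n) : conjugate_exponents p q ->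
  exists2 u : 'cV[R]_n, lpnorm p u <= 1 & lpnorm q v <= dotv u v.
Proof.
case=> [||r s r1 s1 rs].
(* A maximal coordinate is missing only in dimension zero, where the norm is the default [0] of the
   empty maximum. *)
- have [[i vi]|] := pselect (exists i, lpnorm +oo%E v = `|v i ord0|); last first.
    move=> /forallNP vi; exists 0.
      by rewrite lpnorm1E big1// => i _; rewrite mxE normr0.
    suff -> : lpnorm +oo%E v = 0.
      by rewrite dotvE big1// => i _; rewrite mxE mul0r.
    rewrite /lpnorm; case: n v vi => [|n] v vi; first by rewrite big_ord0.
    have [//|j _ jv] := @eq_bigmax _ _ _ 0 (ord0 : 'I_n.+1) xpredT
      (fun i => `|v i ord0|) erefl.
    by have := vi j.
  exists (\col_j (if j == i then Num.sg (v i ord0) else 0)).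
    rewrite lpnorm1E (bigD1 i)//= mxE eqxx big1 ?addr0.
      by rewrite normr_sg lern1 leq_b1.
    by move=> j /negbTE jv; rewrite mxE jv normr0.
  rewrite vi dotvE (bigD1 i)//= mxE eqxx big1 ?addr0.
    by rewrite normrEsg.
  by move=> j /negbTE jv; rewrite mxE jv mul0r.
- exists (\col_j Num.sg (v j ord0)).
    apply/bigmax_leP; split => // j _.
    by rewrite mxE normr_sg lern1 leq_b1.
  rewrite lpnorm1E dotvE; apply: ler_sum => j _.
  by rewrite mxE normrEsg.
have r0 : 0 < r by apply: lt_trans r1.
have s0 : 0 < s by apply: lt_trans s1.
have [v0|v0] := eqVneq (lpnorm s%:E v) 0.
  exists 0; last first.
    by rewrite v0 dotvE big1// => i _; rewrite mxE mul0r.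
  rewrite /= big1 ?powR0 ?invr_eq0 ?gt_eqF// => i _.
  by rewrite mxE normr0 powR0// gt_eqF.
have := powR_sumK v s0.
have : 0 < lpnorm s%:E v by rewrite lt_neqAle eq_sym v0 lpnorm_ge0.
move: (lpnorm s%:E v) => b b0 hb {v0}.
have sN1 : s - 1 != 0 by rewrite subr_eq0 gt_eqF.
(* Since [(s - 1) * r = s], the [r]-th powers of the moduli of these entries sum to one, while
   pairing with [v] gives [b] to the power [s - (s - 1)], that is [b]. *)
exists (\col_j (Num.sg (v j ord0) * `|v j ord0| `^ (s - 1) / b `^ (s - 1))).
  rewrite /= (eq_bigr (fun i => `|v i ord0| `^ s / b `^ s)).
    by rewrite -mulr_suml -hb divff ?powR1// gt_eqF// powR_gt0.
  move=> i _; rewrite mxE.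
  have srs : (s - 1) * r = s.
    have : (r^-1 + s^-1) * (r * s) = r * s by rewrite rs mul1r.
    by rewrite mulrDl mulrA mulVf ?gt_eqF// mulrCA mulVf ?gt_eqF//; lra.
  rewrite !normrM normfV (ger0_norm (powR_ge0 _ _)) (ger0_norm (powR_ge0 _ _)).
  rewrite powRM ?mulr_ge0 ?invr_ge0 ?powR_ge0//.
  rewrite -(powRN b (s - 1)) -(powRrM b) mulNr srs powRN; congr (_ / _).
  have [->|vi0] := eqVneq (v i ord0) 0.
    by rewrite sgr0 normr0 mul0r !powR0 ?gt_eqF.
  by rewrite normr_sg vi0 mul1r -powRrM srs.
rewrite dotvE (eq_bigr (fun i => `|v i ord0| `^ s / b `^ (s - 1))); last first.
  move=> i _; rewrite mxE.
  transitivity (`|v i ord0| * `|v i ord0| `^ (s - 1) / b `^ (s - 1)).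
    by rewrite [X in _ = X * _ / _]normrEsg; ring.
  congr (_ / _); have [->|vi0] := eqVneq `|v i ord0| 0.
    by rewrite mul0r powR0// gt_eqF.
  by rewrite powRB ?vi0 ?implybT// powRr1// mulrCA divff ?mulr1.
rewrite -mulr_suml -hb powRB ?(gt_eqF b0) ?implybT// powRr1 ?(ltW b0)//.
by rewrite invf_div mulrCA divff ?mulr1// gt_eqF// powR_gt0.
Qed.

End lp_duality.

(** * A minimax theorem *)

Section minimax.
Context {R : realType} {V : normedModType R} {L : lmodType R}.
Variables (U : set V) (Y : set L) (f : V -> L -> R) (c : R).
Hypothesis U0 : U !=set0.
Hypothesis U_compact : compact U.
Hypothesis U_convex : forall u v t, U u -> U v -> 0 <= t -> t <= 1 ->
  U (u + t *: (v - u)).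
Hypothesis Y_convex : forall n (w : 'I_n -> R) (y : 'I_n -> L),
  (forall i, 0 <= w i) -> \sum_i w i = 1 -> (forall i, Y (y i)) ->
  Y (\sum_i w i *: y i).
Hypothesis f_affine : forall u v t y,
  f (u + t *: (v - u)) y = f u y + t * (f v y - f u y).
Hypothesis f_linear : forall u n (w : 'I_n -> R) (y : 'I_n -> L),
  f u (\sum_i w i *: y i) = \sum_i w i * f u (y i).
Hypothesis f_continuous : forall y, continuous (f ^~ y : V -> R).
Hypothesis f_ge : forall y, Y y -> exists2 u, U u & c <= f u y.

(** The square of the positive part has derivative [2 * Num.max 0 g], which is 2-Lipschitz in [g];
    this is the resulting quadratic upper bound along a line. *)
Let sqr_posB_le (g d t : R) :
  Num.max 0 (g - t * d) ^+ 2 <=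
  Num.max 0 g ^+ 2 - 2 * t * (Num.max 0 g * d) + t ^+ 2 * d ^+ 2.
Proof.
rewrite !maxEle; case: ifPn => [gtd|gtd]; case: ifPn => [g0|g0].
- by rewrite le_eqVlt; apply/orP; left; apply/eqP; ring.
- rewrite -ltNge in g0.
  rewrite mul0r mulr0 subr0 expr0n/= add0r -exprMn -[leRHS]sqrrN.
  rewrite ler_sqr ?nnegrE//; lra.
- rewrite [leLHS](_ : _ = 0) ?expr0n//.
  rewrite (_ : _ + _ = (g - t * d) ^+ 2) ?sqr_ge0//; ring.
- rewrite [leLHS](_ : _ = 0) ?expr0n//.
  by rewrite mul0r mulr0 subr0 add0r mulr_ge0// sqr_ge0.
Qed.

(* At a minimiser u of [\sum_i max(0, c - f u y_i)^2] over U, the positive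
   parts are, up to normalisation, the weights of a convex combination y of the
   y_i; unless all of them vanish, the first-order condition gives f v y < c
   for all v in U. *)
Lemma finite_minimax n (y : 'I_n -> L) : (forall i, Y (y i)) ->
  exists2 u, U u & forall i, c <= f u (y i).
Proof.
move=> Yy.
pose phi u : R := \sum_i Num.max 0 (c - f u (y i)) ^+ 2.
have phi_cont : continuous phi.
  apply: continuous_big => [|i _]; first exact: add_continuous.
  move=> u; apply: (@continuous_comp _ _ _ (fun v => Num.max 0 (c - f v (y i)))
    (fun t => t ^+ 2)); last exact: exprn_continuous.
  apply: (@continuous_max _ _ (cst 0)); first exact: cvg_cst.
  by apply: cvgB; [exact: cvg_cst|exact: f_continuous].
have [u uU phiu] : exists2 u, u \in U & forall v, v \in U -> phi u <= phi v.
  have [|u uU phiu] := @compact_EVT_max _ _ (- phi) _ U0 U_compact.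
    apply: continuous_subspaceT => v; exact: (cvgN (phi_cont v)).
  by exists u => // v /phiu; rewrite lerN2.
rewrite inE in uU; exists u => //.
pose m i : R := Num.max 0 (c - f u (y i)).
have m_ge0 i : 0 <= m i by rewrite le_max lexx.
have mE i : m i * (c - f u (y i)) = m i ^+ 2.
  by rewrite /m maxEle; case: ifPn => _; rewrite ?mul0r ?expr0n// expr2.
have first_order v : U v -> \sum_i m i * (f v (y i) - f u (y i)) <= 0.
  move=> vU.
  pose d i : R := f v (y i) - f u (y i); pose D : R := \sum_i d i ^+ 2.
  pose S : R := \sum_i m i * d i.
  have D0 : 0 <= D by apply: sumr_ge0 => i _; exact: sqr_ge0.
  have key (t : R) : 0 < t -> t <= 1 -> 2 * S <= t * D.
    move=> t0 t1.
    have := phiu (u + t *: (v - u)).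
    rewrite inE => /(_ (U_convex uU vU (ltW t0) t1)) phile.
    have : phi u <= phi u - 2 * t * S + t ^+ 2 * D.
      apply: (le_trans phile); rewrite /phi /S /D !mulr_sumr -sumrB -big_split/=.
      apply: ler_sum => i _; rewrite f_affine opprD addrA.
      exact: sqr_posB_le.
    move=> h; rewrite -subr_ge0 in h.
    have : 0 <= t * (t * D - 2 * S).
      by apply: le_trans h _; rewrite le_eqVlt; apply/orP; left; apply/eqP; ring.
    by rewrite pmulr_rge0// subr_ge0.
  rewrite leNgt; apply/negP => S0.
  (* This step length lies in []0, 1]] and makes [t * D] smaller than [2 * S], even when [D]
     vanishes, which contradicts [key]. *)
  pose t := S / (S + D).
  have SD0 : 0 < S + D by apply: ltr_pwDl.
  have := key t (divr_gt0 S0 SD0).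
  rewrite ler_pdivrMr// mul1r lerDl => /(_ D0).
  rewrite leNgt => /negP; apply.
  rewrite /t mulrAC ltr_pdivrMr//.
  rewrite -subr_gt0 (_ : _ - _ = S * (2 * S + D)); last by ring.
  by rewrite mulr_gt0// ltr_pwDl// mulr_gt0.
pose M := \sum_i m i.
have M0 : 0 <= M by apply: sumr_ge0.
have [M_eq0 i|M_neq0] := eqVneq M 0.
  move/eqP : M_eq0; rewrite psumr_eq0// => /allP/(_ i (mem_index_enum _))/eqP mi0.
  by rewrite -subr_le0 -mi0 le_max lexx orbT.
have Mgt0 : 0 < M by rewrite lt_neqAle eq_sym M_neq0.
pose w i := m i / M.
have [|v vU] := @f_ge (\sum_i w i *: y i).
  apply: Y_convex => // [i|]; first by rewrite divr_ge0.
  by rewrite -mulr_suml divff.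
rewrite f_linear => cv.
have {}cv : M * c <= \sum_i m i * f v (y i).
  rewrite -ler_pdivlMl// mulr_sumr (le_trans cv)// le_eqVlt; apply/orP; left.
  by apply/eqP/eq_bigr => i _; rewrite /w mulrA (mulrC _ (m i)).
(* By [mE] the sum is [M * c] minus the weighted values at [u]; the choice of [v] bounds [M * c] by
   the weighted values at [v], and [first_order] bounds the difference. *)
have : \sum_i m i ^+ 2 <= 0.
  rewrite (_ : \sum_i _ = M * c - \sum_i m i * f u (y i)); last first.
    by rewrite mulr_suml -sumrB; apply: eq_bigr => i _; rewrite -mE mulrBr.
  rewrite (le_trans _ (first_order v vU))//.
  under [leRHS]eq_bigr do rewrite mulrBr.
  by rewrite sumrB lerB.
move=> m2 i; have : m i ^+ 2 <= 0.
  apply: le_trans m2; rewrite (bigD1 i)//= lerDl sumr_ge0// => j _.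
  exact: sqr_ge0.
rewrite real_exprn_even_le0 ?num_real//= => /eqP mi0.
by rewrite -subr_le0 -mi0 le_max lexx orbT.
Qed.

(** Finitely many of the closed sets [[set u | c <= f u y]] have a common point in [U] by the finite
    case, so compactness yields a point common to all of them. *)
Lemma minimax : exists2 u, U u & forall y, Y y -> c <= f u y.
Proof.
pose F y := U `&` [set u | c <= f u y].
have closedF : closed_fam_of U Y F.
  exists (fun y => [set u | c <= f u y]) => // y Yy.
  apply: (closed_comp _ (@closed_ge _ c)) => u _; exact: f_continuous.
have := U_compact; rewrite compact_In0 => /(_ _ _ _ closedF) [D DY|u Fu].
  pose s : seq L := finmap.enum_fset D.
  pose y (i : 'I_(size s)) : L := nth 0 s i.
  have [|u uU cu] := @finite_minimax _ y.
    by move=> i; apply/set_mem/DY; exact: mem_nth.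
  exists u => z /= zD; split => //=.
  have zD' : (index z s < size s)%N by rewrite index_mem.
  by have := cu (Ordinal zD'); rewrite /y/= nth_index.
(* An empty [Y] leaves [u] unconstrained, possibly outside [U], so any point of [U] is taken
   instead. *)
have [[y Yy]|Y0] := pselect (Y !=set0).
  by exists u => [|z Yz]; [have [] := Fu _ Yy|have [] := Fu _ Yz].
have [v Uv] := U0; exists v => // y Yy.
by exfalso; apply: Y0; exists y.
Qed.

End minimax.

(** * Bilinearity of the pairing and continuity of linear forms *)

Section dotv.
Context {R : realType}.

Lemma dotvDl n (u v w : 'cV[R]_n) : dotv (u + v) w = dotv u w + dotv v w.
Proof. by rewrite /dotv linearD/= mulmxDl mxE. Qed.

Lemma dotvZl n a (u w : 'cV[R]_n) : dotv (a *: u) w = a * dotv u w.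
Proof. by rewrite /dotv linearZ/= -scalemxAl mxE. Qed.

Lemma dotvBl n (u v w : 'cV[R]_n) : dotv (u - v) w = dotv u w - dotv v w.
Proof. by rewrite dotvDl -scaleN1r dotvZl mulN1r. Qed.

Lemma dotv_sumZr n k (w : 'cV[R]_n) (a : 'I_k -> R) (u : 'I_k -> 'cV[R]_n) :
  dotv w (\sum_i a i *: u i) = \sum_i a i * dotv w (u i).
Proof.
rewrite /dotv mulmx_sumr summxE; apply: eq_bigr => i _.
by rewrite -scalemxAr mxE.
Qed.

Lemma dotv_mulmxl m n (M : 'M[R]_(m, n)) u v :
  dotv (M *m u) v = dotv u (M^T *m v).
Proof. by rewrite /dotv trmx_mul mulmxA. Qed.

Lemma dotv_delta n (u : 'cV[R]_n) i : dotv u (delta_mx i ord0) = u i ord0.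
Proof.
rewrite dotvE (bigD1 i)//= mxE !eqxx mulr1 big1 ?addr0// => j /negbTE ji.
by rewrite mxE ji mulr0.
Qed.

(** Expansion over the matrix units writes [f] as a finite combination of coordinate maps. *)
Lemma linear_mx_continuous m n (f : 'M[R]_(m, n) -> R) :
  (forall a u v, f (a *: u + v) = a * f u + f v) -> continuous f.
Proof.
move=> flin.
have f0 : f 0 = 0.
  by have := flin (-1) 0 0; rewrite scaleN1r oppr0 addr0 mulN1r addNr.
have fD u v : f (u + v) = f u + f v by rewrite -[u]scale1r flin mul1r scale1r.
have fZ a u : f (a *: u) = a * f u by rewrite -[_ *: _]addr0 flin f0 addr0.
have -> : f = fun M => \sum_i \sum_j M i j * f (delta_mx i j).
  apply/funext => M; rewrite {1}[M]matrix_sum_delta.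
  rewrite (big_morph f fD f0); apply: eq_bigr => i _.
  by rewrite (big_morph f fD f0); apply: eq_bigr => j _.
apply: continuous_big => [|i _]; first exact: add_continuous.
apply: continuous_big => [|j _]; first exact: add_continuous.
move=> M; apply: (@continuousM _ _ (fun M : 'M[R]_(m, n) => M i j)).
  exact: coord_continuous.
exact: cst_continuous.
Qed.

End dotv.

(** * Minimax over a norm ball *)

Section robust_minimax.
Context {R : realType} (p q : \bar R) (theta : R).
Hypotheses (pq : conjugate_exponents p q) (theta0 : 0 <= theta).

(* The ball of radius theta for the p-norm, described through the dual norm so
   that its convexity and closedness are immediate. *)
Definition dual_ball n : set 'rV[R]_n :=
  [set r | forall v : 'cV[R]_n, dotv r^T v <= theta * lpnorm q v].

(** Membership is tested on a vector of dual norm at most one whose pairing with [r^T] reaches the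
    [p]-norm. *)
Lemma dual_ball_lpnorm n (r : 'rV[R]_n) :
  dual_ball r -> lpnorm p r^T <= theta.
Proof.
move=> Ur.
have [v v1 uv] := lpnorm_dual_attained r^T (conjugate_exponentsC pq).
rewrite (le_trans uv)// dotvC (le_trans (Ur v))//.
by rewrite -[leRHS]mulr1 ler_wpM2l.
Qed.

Lemma dual_ball_scale n (u : 'cV[R]_n) :
  lpnorm p u <= 1 -> dual_ball (theta *: u)^T.
Proof.
move=> u1 v; rewrite trmxK dotvZl ler_wpM2l//.
rewrite (le_trans (dotv_le_lpnorm u v pq))// -[leRHS]mul1r ler_wpM2r//.
exact: lpnorm_ge0.
Qed.

Lemma dual_ball_compact n : compact (@dual_ball n).
Proof.
apply: bounded_closed_compact.
  (* Testing membership on a unit vector and its opposite bounds a coordinate from both sides; [B]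
     sums these bounds to serve all coordinates at once. *)
  pose B := \sum_(i < n) theta * (lpnorm q (delta_mx i ord0 : 'cV[R]_n)
                                 + lpnorm q (- delta_mx i ord0 : 'cV[R]_n)).
  have BE i : theta * (lpnorm q (delta_mx i ord0 : 'cV[R]_n)
      + lpnorm q (- delta_mx i ord0 : 'cV[R]_n)) <= B.
    rewrite /B (bigD1 i)//= lerDl sumr_ge0// => j _.
    by rewrite mulr_ge0// addr_ge0// lpnorm_ge0.
  exists B; split; first exact: num_real.
  move=> x Bx r Ur; rewrite /= (le_trans _ (ltW Bx))//.
  rewrite [leLHS]mx_normrE; apply: bigmax_le => [|[i j] _/=].
    rewrite /B sumr_ge0// => j _.
    by rewrite mulr_ge0// addr_ge0// lpnorm_ge0.
  rewrite (le_trans _ (BE j))// (ord1 i) mulrDr.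
  have h1 := Ur (delta_mx j ord0).
  have := Ur (- delta_mx j ord0).
  rewrite dotvC -scaleN1r dotvZl scaleN1r dotvC mulN1r.
  rewrite dotv_delta mxE in h1 *.
  move=> h2; rewrite ler_norml; apply/andP; split.
    rewrite lerNl (le_trans h2)// lerDr mulr_ge0// lpnorm_ge0//.
  by rewrite (le_trans h1)// lerDl mulr_ge0// lpnorm_ge0.
have -> : @dual_ball n = \bigcap_v [set r | dotv r^T v <= theta * lpnorm q v].
  by apply/seteqP; split=> [r Ur v _|r Ur v]; [exact: Ur|exact: Ur].
apply: closed_bigI => v _.
apply: (closed_comp _ (@closed_le _ _)) => r _.
apply: linear_mx_continuous => a u w.
by rewrite linearD linearZ/= dotvDl dotvZl.
Qed.

(** The term [theta * lpnorm q (M^T *m y)] is the largest value of [dotv (M *m u) y] over the ball,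
    so each [y] has its own good [u]; minimax turns these into one [u] for all [y]. *)
Lemma robust_minimax m n (M : 'M[R]_(n, m)) (a : 'cV[R]_n)
    (Y : set 'cV[R]_n) (c : R) :
  (forall k (w : 'I_k -> R) (y : 'I_k -> 'cV[R]_n),
    (forall i, 0 <= w i) -> \sum_i w i = 1 -> (forall i, Y (y i)) ->
    Y (\sum_i w i *: y i)) ->
  (forall y, Y y -> c <= dotv a y + theta * lpnorm q (M^T *m y)) ->
  exists2 u : 'cV[R]_m, lpnorm p u <= theta &
    forall y, Y y -> c <= dotv (a + M *m u) y.
Proof.
move=> Yconv cY.
have [||||||r Ur rc] := @minimax R _ _ (@dual_ball m) Y
    (fun r y => dotv (a + M *m r^T) y) c _ (@dual_ball_compact m) _ Yconv.
- exists 0 => v; rewrite trmx0 dotvE big1 ?mulr_ge0 ?lpnorm_ge0// => i _.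
  by rewrite mxE mul0r.
- move=> u v t Uu Uv t0 t1 w.
  rewrite linearD linearZ linearB/= dotvDl dotvZl dotvBl.
  have -> : dotv u^T w + t * (dotv v^T w - dotv u^T w) =
    (1 - t) * dotv u^T w + t * dotv v^T w by ring.
  have -> : theta * lpnorm q w =
    (1 - t) * (theta * lpnorm q w) + t * (theta * lpnorm q w) by ring.
  by apply: lerD; apply: ler_wpM2l; rewrite ?subr_ge0.
- move=> u v t y.
  rewrite linearD linearZ linearB/= mulmxDr -scalemxAr mulmxBr.
  by rewrite !dotvDl dotvZl dotvBl; ring.
- by move=> u k w y; rewrite dotv_sumZr.
- move=> y r.
  rewrite (_ : (fun _ => _) = (fun r => dotv a y + dotv (M *m r^T) y)).
    apply: (@continuousD _ _ _ (cst (dotv a y)) (fun r => dotv (M *m r^T) y)).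
      exact: cst_continuous.
    apply: (@linear_mx_continuous _ _ _ (fun r => dotv (M *m r^T) y)) => b u v.
    by rewrite linearD linearZ/= mulmxDr -scalemxAr dotvDl dotvZl.
  by apply/funext => s; rewrite dotvDl.
- move=> y Yy.
  have [u u1 uy] := lpnorm_dual_attained (M^T *m y) pq.
  exists (theta *: u)^T; first exact: dual_ball_scale.
  rewrite trmxK (le_trans (cY y Yy))// dotvDl lerD2l dotv_mulmxl dotvZl.
  by rewrite ler_wpM2l.
by exists r^T => //; exact: dual_ball_lpnorm.
Qed.

End robust_minimax.

(** * Integration along couplings *)

Section integration.
Local Open Scope ereal_scope.
Context {R : realType}.

(** A strict sublevel set of the infimum is a union of open sets, hence open however large [D]
    is. *)
Lemma ereal_inf_continuous_measurable (T : ptopologicalType) I (D : set I)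
    (F : I -> T -> R) : (forall i, D i -> continuous (F i)) ->
  measurable_fun [set: g_sigma_algebraType (@open T)]
    (fun x => ereal_inf [set (F i x)%:E | i in D]).
Proof.
move=> Fc; apply: (measurability _ (ErealGenInftyO.measurableE R)).
move=> _ [_ [r ->] <-]; rewrite setTI; apply: sub_sigma_algebra => /=.
have -> : (fun x => ereal_inf [set (F i x)%:E | i in D]) @^-1` `]-oo, r%:E[ =
    \bigcup_(i in D) (F i @^-1` `]-oo, r[).
  apply/seteqP; split=> [x|x [i Di]]/=; rewrite !in_itv/=.
    by move=> /ereal_inf_lt[_ [i Di <-]] ir; exists i => //=; rewrite in_itv.
  by move=> ir; apply: (@le_lt_trans _ _ (F i x)%:E) => //;
     apply: ereal_inf_lbound; exists i.
apply: bigcup_open => i Di; apply: open_comp => [x _|]; first exact: Fc.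
exact: interval_open.
Qed.

Lemma ge0_integral_image d1 d2 (X : measurableType d1) (Y : measurableType d2)
    (phi : X -> Y) (K : {measure set X -> \bar R}) (P : {measure set Y -> \bar R})
    (f : Y -> \bar R) :
  measurable_fun setT phi ->
  (forall A, measurable A -> P A = K (phi @^-1` A)) ->
  measurable_fun setT f -> (forall y, 0 <= f y) ->
  \int[P]_y f y = \int[K]_x f (phi x).
Proof.
move=> mphi PK mf f0.
pose phi' : {mfun X >-> Y} := HB.pack phi (isMeasurableFun.Build _ _ _ _ _ mphi).
rewrite (eq_measure_integral (pushforward K phi')) => [|A mA _]; last exact: PK.
exact: ge0_integral_pushforward.
Qed.

Lemma integral_full_measure d (X : measurableType d) (P : probability X R)
    (D : set X) (f : X -> \bar R) : measurable D -> P D = 1 ->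
  measurable_fun setT f -> \int[P]_(x in D) f x = \int[P]_x f x.
Proof.
move=> mD PD mf.
have PC : P (~` D) = 0 by rewrite probability_setC// PD subee.
rewrite [LHS]integralE [RHS]integralE; congr (_ - _).
- rewrite [RHS](ge0_negligible_integral (measurableC mD) _ _ _ PC)//.
    by rewrite setTD setCK.
  exact: measurable_funepos.
- rewrite [RHS](ge0_negligible_integral (measurableC mD) _ _ _ PC)//.
    by rewrite setTD setCK.
  exact: measurable_funeneg.
Qed.

(** Both integrals are pulled back to [K] by the projections. Positive and negative parts are
    compared separately, which covers infinite integrals. *)
Lemma coupling_le_integral d (X : measurableType d)
    (P1 P2 : {measure set X -> \bar R}) (K : probability (X * X)%type R)
    (f g : X -> \bar R) :
  coupling P1 P2 K -> measurable_fun setT f -> measurable_fun setT g ->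
  {ae K, forall z, f z.1 <= g z.2} ->
  \int[P1]_x f x <= \int[P2]_x g x.
Proof.
move=> cK mf mg fg.
have P1K A : measurable A -> P1 A = K (fst @^-1` A) by move=> /cK[].
have P2K A : measurable A -> P2 A = K (snd @^-1` A) by move=> /cK[].
rewrite [leLHS]integralE [leRHS]integralE.
have mfp := measurable_funepos mf; have mfn := measurable_funeneg mf.
have mgp := measurable_funepos mg; have mgn := measurable_funeneg mg.
have i1 := ge0_integral_image measurable_fst P1K.
have i2 := ge0_integral_image measurable_snd P2K.
rewrite !i1// !i2//; apply: leeB.
- apply: ae_ge0_le_integral => //.
  + exact: measurableT_comp.
  + exact: measurableT_comp.
  + by apply: filterS fg => z fgz _; rewrite !funeposE ge_max !le_max fgz lexx orbT.
- apply: ae_ge0_le_integral => //.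
  + exact: measurableT_comp.
  + exact: measurableT_comp.
  + apply: filterS fg => z fgz _.
    by rewrite !funenegE ge_max !le_max leeN2 fgz lexx orbT.
Qed.

Lemma ge0_integral_empirical d (X : measurableType d) N (z : 'I_N -> X)
    (f : X -> \bar R) : measurable_fun setT f -> (forall x, 0 <= f x) ->
  \int[empirical R z]_x f x = (N%:R^-1)%:E * \sum_(j < N) f (z j).
Proof.
move=> mf f0.
(* [msum] runs over natural numbers, so the Dirac masses are indexed through [insub]; the default
   [mzero] is never reached below [N]. *)
pose m k : {measure set X -> \bar R} :=
  if insub k is Some j then \d_(z j) else mzero.
have c0 : (0 <= N%:R^-1 :> R)%R by rewrite invr_ge0.
rewrite (eq_measure_integral (mscale (NngNum c0) (msum m N))).
  rewrite ge0_integral_mscale// ge0_integral_measure_sum//; congr (_ * _).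
  apply: eq_bigr => j _; rewrite /m valK integral_dirac// diracT mul1e//.
move=> A _ _ /=; rewrite /mscale /msum /=; congr (_ * _).
by apply: eq_bigr => j _; rewrite /m valK.
Qed.

(** Values [+oo] are allowed, as infeasible recourse produces them; excluding [-oo] at the atoms
    keeps the negative parts finite, so that they cancel. *)
Lemma integral_empirical d (X : measurableType d) N (z : 'I_N -> X)
    (f : X -> \bar R) : measurable_fun setT f -> (forall j, -oo < f (z j)) ->
  \int[empirical R z]_x f x = (N%:R^-1)%:E * \sum_(j < N) f (z j).
Proof.
move=> mf fNy.
rewrite integralE !ge0_integral_empirical//; last 2 first.
  exact: measurable_funeneg.
  exact: measurable_funepos.
have fneg j : f^\- (z j) \is a fin_num.
  by rewrite ge0_fin_numE// funenegE gt_max ltry andbT lteNl; exact: fNy.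
have sneg : \sum_(j < N) f^\- (z j) \is a fin_num by apply/sum_fin_numP => j _ _.
have -> : \sum_(j < N) f^\+ (z j) = \sum_(j < N) f (z j) + \sum_(j < N) f^\- (z j).
  rewrite -big_split/=; apply: eq_bigr => j _.
  by rewrite [in X in _ = X + _](funeposneg f)/= subeK.
by rewrite muleDr ?fin_num_adde_defl// addeK// fin_numM.
Qed.

End integration.

(** * The robust recourse value *)

Section robust_value.
Context {R : realType} {m1 m2 n : nat}.
Variables (Q : 'M[R]_(n, m1)) (a : 'cV[R]_n) (Y : set 'cV[R]_n).
Variables (p q : \bar R).
Hypotheses (pq : conjugate_exponents p q) (p_gt0 : (0 < p)%E).

(** The set [Y] does not vary with [xi]: on the support the lower block is fixed, and with it the
    feasible set. *)
Definition robust_value (theta : R) (xi : 'cV[R]_(m1 + m2)) : \bar R :=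
  ereal_inf [set (dotv (Q *m usubmx xi + a) y
                  + theta * lpnorm q (Q^T *m y))%:E | y in Y].

Lemma measurable_robust_value theta :
  measurable_fun [set: borel_cV R (m1 + m2)] (robust_value theta).
Proof.
apply: ereal_inf_continuous_measurable => y _.
rewrite (_ : (fun _ => _) = (fun xi : 'cV[R]_(m1 + m2) =>
    dotv (Q *m usubmx xi) y + (dotv a y + theta * lpnorm q (Q^T *m y)))).
  move=> xi; apply: (@continuousD _ _ _ (fun xi : 'cV[R]_(m1 + m2) =>
    dotv (Q *m usubmx xi) y) (cst _)); last exact: cst_continuous.
  apply: (@linear_mx_continuous _ _ _ (fun xi : 'cV[R]_(m1 + m2) =>
    dotv (Q *m usubmx xi) y)) => b u v.
  by rewrite linearD linearZ/= mulmxDr -scalemxAr dotvDl dotvZl.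
by apply/funext => xi; rewrite dotvDl addrA.
Qed.

(** For fixed [y], passing from [zeta] to [xi] adds the pairing of the shift of the upper block with
    [Q^T *m y], which Hoelder bounds by the penalty. *)
Lemma robust_value_shift theta xi zeta : lpnorm p (xi - zeta) <= theta ->
  (robust_value 0 xi <= robust_value theta zeta)%E.
Proof.
move=> xizeta; apply/ereal_infP => _ [y Yy <-].
apply: (@le_trans _ _ (dotv (Q *m usubmx xi + a) y)%:E).
  by apply: ereal_inf_lbound; exists y => //; rewrite mul0r addr0.
have -> : Q *m usubmx xi + a =
    Q *m usubmx (xi - zeta) + (Q *m usubmx zeta + a).
  by rewrite linearB/= mulmxBr addrA subrK.
rewrite lee_fin dotvDl addrC lerD2l dotv_mulmxl.
rewrite (le_trans (dotv_le_lpnorm _ _ pq))// ler_wpM2r ?lpnorm_ge0//.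
by rewrite (le_trans _ xizeta)// lpnorm_usubmx_le.
Qed.

Lemma robust_value_attained theta zeta : 0 <= theta ->
  (forall k (w : 'I_k -> R) (y : 'I_k -> 'cV[R]_n),
    (forall i, 0 <= w i) -> \sum_i w i = 1 -> (forall i, Y (y i)) ->
    Y (\sum_i w i *: y i)) ->
  (-oo < robust_value theta zeta)%E ->
  exists xi, [/\ lpnorm p (xi - zeta) <= theta, dsubmx xi = dsubmx zeta &
    (robust_value theta zeta <= robust_value 0 xi)%E].
Proof.
move=> theta0 Yconv valNy.
(* The value [+oo] occurs only for an empty [Y], where any real [c] will do. *)
have [c cY valc] : exists2 c : R,
    (forall y, Y y -> c <= dotv (Q *m usubmx zeta + a) y
                           + theta * lpnorm q (Q^T *m y)) &
    (Y !=set0 -> robust_value theta zeta = c%:E).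
  have lb y : Y y -> (robust_value theta zeta <=
      (dotv (Q *m usubmx zeta + a) y + theta * lpnorm q (Q^T *m y))%:E)%E.
    by move=> Yy; apply: ereal_inf_lbound; exists y.
  case: (robust_value theta zeta) lb valNy => [c| |]// lb _.
    by exists c.
  by exists 0 => [y /lb//|[y /lb]].
have [u ule uc] := robust_minimax pq theta0 Yconv cY.
(* Padding by zero preserves the norm of the shift and leaves the lower block in place. *)
exists (zeta + col_mx u 0); split.
- by rewrite addrAC subrr add0r lpnorm_col_mx0.
- by rewrite linearD/= col_mxKd addr0.
apply/ereal_infP => _ [y Yy <-]; rewrite valc; last by exists y.
rewrite lee_fin mul0r addr0 linearD/= col_mxKu mulmxDr addrAC.
exact: uc.
Qed.

(** Upper semicontinuity from the right: the objective at a nearly optimal [y] grows only slightly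
    when [theta] does. *)
Lemma robust_value_near theta zeta (e : R) : 0 < e ->
  (-oo < robust_value theta zeta)%E ->
  \forall d \near 0^'+,
    (robust_value (theta + d) zeta <= robust_value theta zeta + e%:E)%E.
Proof.
move=> e0; case val : (robust_value theta zeta) => [r| |]// _; last first.
  by apply: nearW => d; exact: leey.
have [] := @ereal_inf_lt _ [set (dotv (Q *m usubmx zeta + a) y
                  + theta * lpnorm q (Q^T *m y))%:E | y in Y] (r + e)%:E.
  by move: val; rewrite /robust_value => ->; rewrite lte_fin ltrDl.
move=> _ [y Yy <-]; rewrite lte_fin -subr_gt0.
set v := dotv _ _ + _ => ve.
(* Adding one keeps the divisor positive when the norm vanishes. *)
have B0 : 0 < lpnorm q (Q^T *m y) + 1 by rewrite ltr_wpDl// lpnorm_ge0.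
near=> d.
apply: (@le_trans _ _ (dotv (Q *m usubmx zeta + a) y
                  + (theta + d) * lpnorm q (Q^T *m y))%:E).
  by apply: ereal_inf_lbound; exists y.
rewrite -EFinD lee_fin mulrDl addrA -/v -lerBrDl.
have d0 : 0 < d by near: d; exact: nbhs_right_gt.
have : d <= (r + e - v) / (lpnorm q (Q^T *m y) + 1).
  by near: d; apply: nbhs_right_le; rewrite divr_gt0.
rewrite ler_pdivlMr//; apply: le_trans.
by rewrite ler_wpM2l ?(ltW d0)// ler_wpDr.
Unshelve. all: by end_near. Qed.

End robust_value.

(** * Empirical distributions in the ambiguity set *)

Section empirical_couplings.
Context {R : realType} {m N : nat} (N0 : (0 < N)%N).
Implicit Types (xi zeta : 'I_N -> borel_cV R m).

Lemma borel_cV_closed (A : set 'cV[R]_m) : closed A ->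
  measurable (A : set (borel_cV R m)).
Proof.
move=> /closed_openC Ao; rewrite -[A]setCK; apply: measurableC.
exact: sub_sigma_algebra.
Qed.

(** Taking all coordinates gives singletons; taking the lower ones gives the support. *)
Lemma closed_coord (B : set 'I_m) (v : 'cV[R]_m) :
  closed [set u : 'cV[R]_m | forall i, B i -> u i ord0 = v i ord0].
Proof.
rewrite (_ : mkset _ =
    \bigcap_(i in B) ((fun u : 'cV[R]_m => u i ord0) @^-1` [set v i ord0])).
  apply: closed_bigI => i _; apply: (closed_comp _ (@closed_eq _ _)) => u _.
  exact: coord_continuous.
by apply/seteqP; split.
Qed.

(** The empirical measure of the pairs of [xi j] and [zeta j] is a coupling of cost at most
    [theta]. *)
Lemma ambiguity_set_empirical p (theta : R) (Xi : set 'cV[R]_m) xi zeta :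
  (forall j, lpnorm p ((xi j : 'cV[R]_m) - zeta j) <= theta) ->
  (forall j, Xi (xi j)) ->
  exists2 P : probability (borel_cV R m) R,
    (P : set _ -> \bar R) = empirical R xi & ambiguity_set p theta Xi zeta P.
Proof.
move=> xizeta Xixi.
pose P : probability (borel_cV R m) R :=
  HB.pack (empirical R xi)
    (Measure_isProbability.Build _ _ _ (empirical R xi)
       (empirical_setT R xi N0)).
exists P => //; split.
  rewrite /P/= /empirical (eq_bigr (fun=> 1%E)).
    by rewrite sumEFin sumr_const card_ord -EFinM mulVf// pnatr_eq0 -lt0n.
  by move=> j _; rewrite diracE mem_set.
pose xz j : (borel_cV R m * borel_cV R m)%type := (xi j, zeta j).
pose K : probability (borel_cV R m * borel_cV R m)%type R :=
  HB.pack (empirical R xz)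
    (Measure_isProbability.Build _ _ _ (empirical R xz)
       (empirical_setT R xz N0)).
apply: (@le_trans _ _ (ess_sup K
    (fun z => (lpnorm p ((z.1 : 'cV[R]_m) - (z.2 : 'cV[R]_m)))%:E))).
  by apply: ereal_inf_lbound; exists K.
apply/ess_supP.
(* [S] collects the atoms of [K]; its complement is null, and the cost bound can fail only there. *)
pose S := \bigcup_(j in [set: 'I_N]) ([set xi j] `*` [set zeta j]).
have mset1 (v : borel_cV R m) : measurable [set v].
  apply: borel_cV_closed; rewrite (_ : [set v] =
    [set u : 'cV[R]_m | forall i, [set: 'I_m] i -> u i ord0 = v i ord0]).
    exact: closed_coord.
  apply/seteqP; split=> [u -> //|u uv].
  by apply/colP => i; exact: uv.
exists (~` S); split.
- apply: measurableC; apply: fin_bigcup_measurable => // j _.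
  exact: measurableX.
- rewrite /K/= /empirical big1 ?mule0// => j _.
  by rewrite diracE memNset// => /(_ _)[]; exists j.
- move=> [u v]/=; apply: contra_not => /= -[j _ [/= -> ->]].
  by rewrite lee_fin.
Qed.

End empirical_couplings.

(** * The two inequalities for the worst-case expectation *)

Section recourse.
Context {R : realType} {n1 n2 m1 m2 l N : nat} (N0 : (0 < N)%N).
Variables (W : 'M[R]_(l, n2)) (Q : 'M[R]_(n2, m1)) (q : 'cV[R]_n2).
Variables (h : 'cV[R]_n1 -> 'cV[R]_l) (T : 'cV[R]_n1 -> 'M[R]_(l, m2)).
Variables (x : 'cV[R]_n1) (xiT : 'cV[R]_m2).

Let Y := recourse_feasible W h T x xiT.
Let Xi := support_prod [set: 'cV[R]_m1] [set xiT].

Lemma recourse_feasible_convex k (w : 'I_k -> R) (y : 'I_k -> 'cV[R]_n2) :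
  (forall i, 0 <= w i) -> \sum_i w i = 1 -> (forall i, Y (y i)) ->
  Y (\sum_i w i *: y i).
Proof.
move=> w0 w1 Yy i; rewrite mulmx_sumr mxE summxE.
rewrite -[leLHS]mul1r -[X in _ <= X + _]mul1r -w1 !mulr_suml -big_split/=.
apply: ler_sum => j _; rewrite -scalemxAr [X in _ + X]mxE -mulrDr ler_wpM2l//.
by have := Yy j i; rewrite mxE.
Qed.

Lemma recourse_robust_value r xi : Xi xi ->
  recourse W Q q h T x xi = robust_value Q q Y r 0 xi.
Proof.
move=> [_ /= xiE]; rewrite /recourse xiE /robust_value; congr ereal_inf.
by apply: eq_imagel => y _; rewrite mul0r addr0.
Qed.

(** Weak duality: a dual feasible [pi] bounds every objective value below by
    [dotv pi (h x - T x *m xiT)], and the penalty is nonnegative. *)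
Lemma robust_value_gtNy r theta (xi : 'cV[R]_(m1 + m2)) : 0 <= theta ->
  (exists pi : 'cV[R]_l,
    (forall i, 0 <= pi i ord0) /\ W^T *m pi = Q *m usubmx xi + q) ->
  (-oo < robust_value Q q Y r theta xi)%E.
Proof.
move=> theta0 [pi [pi0 piE]].
apply: (@lt_le_trans _ _ (dotv pi (h x - T x *m xiT))%:E); first exact: ltNyr.
apply/ereal_infP => _ [y Yy <-].
rewrite lee_fin -piE ler_wpDr ?mulr_ge0 ?lpnorm_ge0//.
rewrite dotv_mulmxl trmxK !dotvE; apply: ler_sum => i _.
rewrite ler_wpM2l//.
by have := Yy i; rewrite !mxE lerBlDl.
Qed.

Lemma measurable_fixed_block : measurable (Xi : set (borel_cV R (m1 + m2))).
Proof.
apply: borel_cV_closed.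
rewrite (_ : Xi = [set u : 'cV[R]_(m1 + m2) |
    forall i, [set i : 'I_(m1 + m2) | (m1 <= i)%N] i -> u i ord0 = (col_mx 0 xiT) i ord0]).
  exact: closed_coord.
apply/seteqP; split => [xi [_ /= <-] i /=|xi xiE].
  case: (split_ordP i) => j ->; first by rewrite /= leqNgt ltn_ord.
  by rewrite col_mxEd mxE.
split=> //=; apply/colP => j; rewrite mxE xiE ?col_mxEd//=.
by rewrite leq_addr.
Qed.

Variables (p r : \bar R) (theta : R).
Hypotheses (pr : conjugate_exponents p r) (p_gt0 : (0 < p)%E).
Hypotheses (theta0 : 0 <= theta).
Hypothesis dual_feasible : forall xi, Xi xi ->
  exists pi : 'cV[R]_l,
    (forall i, 0 <= pi i ord0) /\ W^T *m pi = Q *m usubmx xi + q.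
Variable zeta : 'I_N -> 'cV[R]_(m1 + m2).
Hypothesis Xi_zeta : forall j, Xi (zeta j).

Let G := @robust_value R m1 m2 n2 Q q Y r.

(** Dual feasibility is assumed on [Xi] only; since it concerns the upper block alone, the lower
    block of [xi] is first replaced by [xiT]. *)
Let G_gtNy t xi : 0 <= t -> (-oo < G t xi)%E.
Proof.
move=> t0; apply: robust_value_gtNy => //.
have [|pi [pi0 piE]] := @dual_feasible (col_mx (usubmx xi) xiT).
  by split => //=; rewrite col_mxKd.
by exists pi; split => //; rewrite piE col_mxKu.
Qed.

Let integral_recourse (P : probability (borel_cV R (m1 + m2)) R) : P Xi = 1%E ->
  (\int[P]_(xi in Xi) recourse W Q q h T x xi = \int[P]_xi G 0 xi)%E.
Proof.
move=> PXi; rewrite -(integral_full_measure measurable_fixed_block PXi).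
  by apply: eq_integral => xi /set_mem; exact: recourse_robust_value.
exact: measurable_robust_value.
Qed.

Lemma worst_case_le :
  (worst_case Xi W Q q h T p theta zeta x <=
   (N%:R^-1)%:E * \sum_(j < N) G theta (zeta j))%E.
Proof.
apply/ereal_supP => _ [P [PXi wP] <-].
rewrite integral_recourse//.
have le_shift d : 0 < d -> (\int[P]_xi G 0 xi <=
    (N%:R^-1)%:E * \sum_(j < N) G (theta + d) (zeta j))%E.
  move=> d0.
  have thd : (theta%:E < (theta + d)%:E)%E by rewrite lte_fin ltrDl.
  (* The slack [d] makes the bound strict, which yields a coupling [K] of cost below [theta + d]. *)
  have [_ [K cK <-] /ltW/ess_supP Kd] := ereal_inf_lt (le_lt_trans wP thd).
  rewrite -(@integral_empirical _ _ (borel_cV R (m1 + m2)) _ _ (G (theta + d))).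
  - apply: (coupling_le_integral cK); try exact: measurable_robust_value.
    apply: filterS Kd => z; rewrite lee_fin => zd.
    exact: (robust_value_shift _ _ _ pr p_gt0 zd).
  - exact: measurable_robust_value.
  - by move=> j; apply: G_gtNy; rewrite addr_ge0// ltW.
apply/lee_addgt0Pr => e e0.
(* As there are finitely many atoms, one [d] serves all of them. *)
have : \forall d \near 0^'+, forall j,
    (G (theta + d) (zeta j) <= G theta (zeta j) + e%:E)%E.
  by apply: filter_forall => j; apply: robust_value_near => //; exact: G_gtNy.
have d_gt0 : \forall d \near (0 : R)^'+, 0 < d by exact: nbhs_right_gt.
move=> /(filterI d_gt0)/filter_ex[d [d0 dG]].
apply: (le_trans (le_shift d d0)).
have c0 : (0 <= (N%:R^-1 : R)%:E)%E by rewrite lee_fin invr_ge0.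
apply: (@le_trans _ _ ((N%:R^-1)%:E * \sum_(j < N) (G theta (zeta j) + e%:E))%E).
  by apply: lee_wpmul2l => //; apply: lee_sum => j _; exact: dG.
(* The average of [N] copies of [e] is [e]; being finite, it separates from values that may be
   [+oo]. *)
rewrite big_split/= sumEFin sumr_const card_ord muleDr ?fin_num_adde_defl//.
by rewrite leeD2l// -EFinM lee_fin -[e *+ N]mulr_natr mulrCA mulVf ?mulr1// pnatr_eq0 -lt0n.
Qed.

Lemma worst_case_ge :
  ((N%:R^-1)%:E * \sum_(j < N) G theta (zeta j) <=
   worst_case Xi W Q q h T p theta zeta x)%E.
Proof.
have /choice[/= xi xiP] : forall j, exists xi,
    [/\ lpnorm p (xi - zeta j) <= theta, dsubmx xi = dsubmx (zeta j) &
    (G theta (zeta j) <= G 0 xi)%E].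
  move=> j; apply: robust_value_attained => //; last exact: G_gtNy.
  exact: recourse_feasible_convex.
have [||P PE ambP] := @ambiguity_set_empirical R _ _ N0 p theta Xi xi zeta.
- by move=> j; have [] := xiP j.
(* The moved points keep their lower block and so remain in [Xi], whose upper block is free. *)
- move=> j; split=> //=; have [_ -> _] := xiP j.
  by have [] := Xi_zeta j.
apply: (@le_trans _ _ (\int[P]_(xi in Xi) recourse W Q q h T x xi)%E); last first.
  by apply: ereal_sup_ubound; exists P.
rewrite integral_recourse; last by case: ambP.
rewrite (eq_measure_integral (empirical R (xi : 'I_N -> borel_cV R (m1 + m2)))) => [|A _ _]; last first.
  exact: (congr1 (@^~ A) PE).
rewrite integral_empirical.
- apply: lee_wpmul2l; first by rewrite lee_fin invr_ge0.
  by apply: lee_sum => j _; have [] := xiP j.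
- exact: measurable_robust_value.
- by move=> j; exact: G_gtNy.
Qed.

End recourse.

Theorem theorem2 (R : realType) (n1 n2 m1 m2 l N : nat)
  (hn1 : (0 < n1)%N) (hn2 : (0 < n2)%N) (hm1 : (0 < m1)%N) (hm2 : (0 < m2)%N)
  (hl : (0 < l)%N) (hN : (0 < N)%N)
  (X : set 'cV[R]_n1)
  (W : 'M[R]_(l, n2)) (Q : 'M[R]_(n2, m1)) (q : 'cV[R]_n2)
  (h : 'cV[R]_n1 -> 'cV[R]_l) (T : 'cV[R]_n1 -> 'M[R]_(l, m2))
  (h_affine : affine_map h) (T_affine : affine_map T)
  (Xi_q : set 'cV[R]_m1) (Xi_T : set 'cV[R]_m2)
  (p : \bar R) (hp : (1 <= p)%E) (theta : R) (htheta : 0 <= theta)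
  (zeta : 'I_N -> 'cV[R]_(m1 + m2))
  (hzeta : forall j, support_prod Xi_q Xi_T (zeta j))
  (hdual : expensive_recourse X (support_prod Xi_q Xi_T) W Q q)
  (xiT : 'cV[R]_m2)
  (hXi : support_prod Xi_q Xi_T = support_prod [set: 'cV[R]_m1] [set xiT])
  (x : 'cV[R]_n1) (hx : X x) :
  worst_case (support_prod Xi_q Xi_T) W Q q h T p theta zeta x =
  ((N%:R^-1)%:E * \sum_(j < N)
     ereal_inf [set (dotv (Q *m usubmx (zeta j) + q) y
                     + theta * lpnorm (hoelder_conjugate p) (Q^T *m y))%:E
               | y in recourse_feasible W h T x xiT])%E.
Proof.
have pr := hoelder_conjugateW hp.
have p0 : (0 < p)%E by apply: lt_le_trans hp.
have dual xi : support_prod [set: 'cV[R]_m1] [set xiT] xi -> exists pi : 'cV[R]_l,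
    (forall i, 0 <= pi i ord0) /\ W^T *m pi = Q *m usubmx xi + q.
  by rewrite -hXi => Xixi; exact: (hdual _ _ hx Xixi).
rewrite hXi in hzeta *.
apply/eqP; rewrite eq_le; apply/andP; split.
  exact: worst_case_le.
exact: worst_case_ge.
Qed.
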